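(* Let $n\ge1$. For each $q\in\{1,2,\ldots,c_n-1\}$, the permutation $\mathcal{D}_n(q+1)$ is obtained from $\mathcal{D}_n(q)$ by a rotation of two, three or four elements, i.e. by cyclically permuting the entries occupying some set of two, three or four positions (in particular, $\mathcal{D}_n(q)$ and $\mathcal{D}_n(q+1)$ differ in at most four positions).
   Context: Let $c_n=\frac{1}{n+1}\binom{2n}{n}$ be the $n$-th Catalan number. Let $A(1)=0$ and $A(i)=c_0+c_1+\cdots+c_{i-2}$ for $i>1$. Lists of permutations are written as ordered sequences; the $j$-th entry of a list $\mathcal{D}_n$ is $\mathcal{D}_n(j)$. For a positive integer $i$, $\mathcal{D}_n^i$ denotes $\mathcal{D}_n$ if $i$ is odd and the reversal of $\mathcal{D}_n$ if $i$ is even, so $\mathcal{D}_n^i(j)=\mathcal{D}_n^{i+1}(c_n+1-j)$. For a permutation (word) $w$ and integer $l$, $w+l$ denotes $w$ with every entry increased by $l$. $[\alpha,n,\beta]$ denotes the word obtained by concatenating the word $\alpha$, the letter $n$, and the word $\beta$; concatenation with the empty permutation $\emptyset$ leaves a word unchanged. $\bigoplus$ denotes concatenation of lists in the order of the indices (outer index varying slowest). Define $\mathcal{D}_0=(\emptyset)$ and for $n\ge1$ $$\mathcal{D}_n=\bigoplus_{i=1}^{n}\bigoplus_{j=1}^{c_{i-1}}\bigoplus_{k=1}^{c_{n-i}}\left[\mathcal{D}_{i-1}^{\,n+i-1}(j),\ n,\ \mathcal{D}_{n-i}^{\,j+A(i)+1}(k)+(i-1)\right].$$ (The list $\mathcal{D}_n$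 consists of the $231$-avoiding permutations of $\{1,\ldots,n\}$.) *)

(* Defs.v *)
From mathcomp Require Import all_boot.
Set Implicit Arguments.
Unset Strict Implicit.
Unset Printing Implicit Defensive.

(* The division is exact. *)
Definition catalan (n : nat) : nat := 'C(n.*2, n) %/ n.+1.

(* The offset A(i) = c_0 + ... + c_{i-2}, an empty sum for i = 1. *)
Definition offset (i : nat) : nat := \sum_(0 <= m < i.-1) catalan m.

(* Permutations of {1, ..., n} are in one-line notation, with letters starting
   at 1. *)
Definition word := seq nat.

Definition shiftw (w : word) (l : nat) : word := [seq x + l | x <- w].

Definition signed_list (L : seq word) (i : nat) : seq word :=
  if odd i then L else rev L.

(* Entries of a list of words are numbered from 1. *)
Definition entry (L : seq word) (j : nat) : word := nth [::] L j.-1.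

(* The right-hand side of the recurrence, as a function of the earlier lists. *)
Definition D_step (D : nat -> seq word) (n : nat) : seq word :=
  flatten [seq
    flatten [seq
      [seq entry (signed_list (D i.-1) (n + i - 1)) j
             ++ n :: shiftw (entry (signed_list (D (n - i)) (j + offset i + 1)) k)
                            (i - 1)
      | k <- iota 1 (catalan (n - i))]
    | j <- iota 1 (catalan i.-1)]
  | i <- iota 1 n].

(* The recurrence uses all the earlier lists, hence the table
   [:: D 0; ...; D n]; see D0 and D_rec. *)
Fixpoint D_table (n : nat) : seq (seq word) :=
  if n is m.+1 then
    let T := D_table m in rcons T (D_step (nth [::] T) m.+1)
  else [:: [:: [::]]].

Definition D (n : nat) : seq word := nth [::] (D_table n) n.

Lemma size_D_table n : size (D_table n) = n.+1.
Proof. by elim: n => //= n IHn; rewrite size_rcons IHn. Qed.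

Lemma nth_D_table n m : m <= n -> nth [::] (D_table n) m = D m.
Proof.
elim: n => [|n IHn]; first by rewrite leqn0 => /eqP ->.
rewrite leq_eqVlt => /orP[/eqP -> //|lt_mn].
by rewrite /= nth_rcons size_D_table lt_mn IHn.
Qed.

Lemma D0 : D 0 = [:: [::]].
Proof. by []. Qed.

Lemma D_rec n : 0 < n -> D n = D_step D n.
Proof.
case: n => // n _; rewrite /D /= nth_rcons size_D_table ltnn eqxx /D_step.
congr flatten; apply/eq_in_map => i; rewrite mem_iota => /andP[i_gt0 lt_in].
have le1 : i.-1 <= n by rewrite -ltnS prednK.
have le2 : n.+1 - i <= n by rewrite leq_subLR addnC -addn1 leq_add2l.
by rewrite !nth_D_table.
Qed.

Example D3 :
  D 3 = [:: [:: 3; 1; 2]; [:: 3; 2; 1]; [:: 1; 3; 2]; [:: 2; 1; 3]; [:: 1; 2; 3]].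
Proof. by rewrite /D /= /D_step /offset unlock. Qed.

(* v is obtained from w by cyclically permuting the entries at the positions
   listed in ps (numbered from 0): along the cyclic order of ps, each position
   receives the entry of the next one.  The positions in ps may be in any
   order, and next ps p = p when p is not in ps. *)
Definition rotation_at (ps : seq nat) (w v : word) : Prop :=
  [/\ uniq ps, all (fun p => p < size w) ps, size v = size w
    & forall p, p < size w -> nth 0 v p = nth 0 w (next ps p)].

Definition rotation_of_2_3_4 (w v : word) : Prop :=
  exists ps : seq nat, 2 <= size ps <= 4 /\ rotation_at ps w v.

Definition num_diff (n : nat) (w v : word) : nat :=
  count (fun p => nth 0 w p != nth 0 v p) (iota 0 n).

(* Main.v *)
(* D_n starts with n 1 2 ... (n-1) and ends with 1 2 ... n.  Within a block of
   the recurrence, consecutive words differ by a rotation of the factor on one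
   side of the letter n, the exponents of the lists being such that the other
   factor stays fixed.  Between the blocks i and i+1 both factors are endpoints
   of their lists, and the four parity patterns give rotations of two, three,
   three and four elements. *)
Require Import Defs.
From mathcomp Require Import all_boot.
From mathcomp Require Import zify.
Set Implicit Arguments.
Unset Strict Implicit.
Unset Printing Implicit Defensive.

(** * Catalan numbers *)

(** The division is exact: n+1 divides (2n+1) C(2n,n) = (n+1) C(2n+1,n+1) and is coprime to 2n+1. *)
Lemma mulSn_catalan n : n.+1 * catalan n = 'C(n.*2, n).
Proof.
rewrite /catalan mulnC divnK // -(@Gauss_dvdr _ n.*2.+1).
  by rewrite (mul_bin_diag n.*2.+1 n) dvdn_mulr.
by rewrite -addnn -addnS /coprime gcdnDr -/(coprime _ _) coprimeSn.
Qed.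

Lemma central_binS n :
  n.+1 * 'C(n.+1.*2, n.+1) = 2 * n.*2.+1 * 'C(n.*2, n).
Proof.
have h1 := mul_bin_diag n.*2.+2 n; have h2 := mul_bin_diag n.*2.+1 n.
have h3 : 'C(n.*2.+1, n) = 'C(n.*2.+1, n.+1).
  by rewrite -[LHS]bin_sub; [congr binomial|]; lia.
rewrite doubleS -h1 /= h3; rewrite /= in h2; nia.
Qed.

Lemma catalanS n : n.+2 * catalan n.+1 = (4 * n + 2) * catalan n.
Proof.
have h := central_binS n; rewrite -!mulSn_catalan in h.
apply/eqP; rewrite -(eqn_pmul2l (ltn0Sn n)) h; apply/eqP; nia.
Qed.

Lemma catalan_gt0 n : 0 < catalan n.
Proof.
have : 0 < n.+1 * catalan n by rewrite mulSn_catalan bin_gt0; lia.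
by rewrite muln_gt0.
Qed.

(* With S_n the left-hand side and T_n := \sum_i (i + 1) c_i c_(n-i), symmetry
   gives 2 T_n = (n + 2) S_n, and the recurrence for (i + 2) c_(i+1) gives
   T_(n+1) = c_(n+1) + 2 (n + 1) S_n. *)
Lemma catalan_convolution n :
  \sum_(i < n.+1) catalan i * catalan (n - i) = catalan n.+1.
Proof.
pose S n := \sum_(i < n.+1) catalan i * catalan (n - i).
pose T n := \sum_(i < n.+1) i.+1 * (catalan i * catalan (n - i)).
have TS m : 2 * T m = m.+2 * S m.
  rewrite mul2n -addnn {1}/T (reindex_inj rev_ord_inj) -big_split big_distrr.
  apply: eq_bigr => i _ /=; rewrite subSS.
  have le_im : i <= m by rewrite -ltnS.
  by rewrite subKn // (mulnC (catalan (m - i))) -mulnDl; congr (_ * _); lia.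
have TSS m : T m.+1 = catalan m.+1 + 2 * m.+1 * S m.
  rewrite /T big_ord_recl subn0 mul1n (_ : catalan 0 = 1) // mul1n.
  congr (_ + _).
  transitivity (\sum_(i < m.+1) (4 * i + 2) * (catalan i * catalan (m - i))).
    by apply: eq_bigr => i _; rewrite lift0 subSS !mulnA catalanS.
  (* Adding [2 * S m] turns the weight 4i+2 into 4(i+1), which gives [4 * T m]. *)
  apply/eqP; rewrite -(eqn_add2r (2 * S m)); apply/eqP.
  transitivity (4 * T m); last by have := TS m; nia.
  rewrite /S /T !big_distrr -big_split; apply: eq_bigr => i _ /=; nia.
rewrite -/(S n); elim: n => [|n IHn]; first by rewrite /S big_ord1.
have h1 := TS n.+1; have h2 := TSS n; have h3 := catalanS n.+1.
apply/eqP; rewrite -(eqn_pmul2l (ltn0Sn n.+2)) -h1 h2 h3 IHn; apply/eqP; nia.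
Qed.

(** * Rotations *)

(** Reversing the cycle inverts the rotation: [next] on [rev ps] is [prev] on [ps]. *)
Lemma rotation_sym w v : rotation_of_2_3_4 w v -> rotation_of_2_3_4 v w.
Proof.
case=> ps [szps [ups /allP psw szv rot]]; exists (rev ps).
rewrite size_rev; split=> //; split; rewrite ?rev_uniq ?all_rev ?szv //.
  exact/allP.
move=> p lt_p; rewrite next_rev // rot ?next_prev //.
by have [p_ps|p_ps] := boolP (p \in ps);
  [apply: psw; rewrite mem_prev | rewrite prev_nth (negPf p_ps)].
Qed.

Lemma rotation_at_next_lt ps w v p :
  rotation_at ps w v -> p < size w -> next ps p < size w.
Proof.
case=> _ /allP psw _ _ lt_p.
have [p_ps|p_ps] := boolP (p \in ps); first by apply: psw; rewrite mem_next.
by rewrite next_nth (negPf p_ps).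
Qed.

Lemma rotation_catl a w v :
  rotation_of_2_3_4 w v -> rotation_of_2_3_4 (a ++ w) (a ++ v).
Proof.
case=> ps [szps rot]; have [ups psw szv rotE] := rot.
exists (map (addn (size a)) ps); rewrite size_map; split=> //.
split; first by rewrite map_inj_uniq //; apply: addnI.
- by rewrite all_map size_cat; apply: sub_all psw => p /=; rewrite ltn_add2l.
- by rewrite !size_cat szv.
move=> p; rewrite size_cat => lt_p; rewrite nth_cat.
case: ltnP => [lt_pa|le_ap].
  have p_ps : p \notin map (addn (size a)) ps.
    by apply/mapP => -[r _ def_p]; lia.
  by rewrite next_nth (negPf p_ps) nth_cat lt_pa.
rewrite -{2}(subnKC le_ap) next_map //; last exact: addnI.
by rewrite nth_cat ltnNge leq_addr addKn rotE //; lia.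
Qed.

Lemma rotation_catr w v b :
  rotation_of_2_3_4 w v -> rotation_of_2_3_4 (w ++ b) (v ++ b).
Proof.
case=> ps [szps rot]; have [ups psw szv rotE] := rot; exists ps; split=> //.
split=> //; last 2 first.
- by rewrite !size_cat szv.
- move=> p _; rewrite !nth_cat szv; case: ltnP => [lt_p|le_p].
    by rewrite (rotation_at_next_lt rot lt_p) rotE.
  have p_ps : p \notin ps.
    by apply/negP => /(allP psw) /=; rewrite ltnNge le_p.
  by rewrite next_nth (negPf p_ps) ltnNge le_p.
by apply: sub_all psw => p /= lt_p; rewrite size_cat ltn_addr.
Qed.

Lemma rotation_shiftw w v l :
  rotation_of_2_3_4 w v -> rotation_of_2_3_4 (shiftw w l) (shiftw v l).
Proof.
case=> ps [szps rot]; have [ups psw szv rotE] := rot; exists ps; split=> //.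
split; rewrite ?size_map // => p lt_p.
by rewrite !(nth_map 0) ?szv ?(rotation_at_next_lt rot) // rotE.
Qed.

(** The factor [b] stays in place, while the first letter and the last [size c + 1] letters move in
    one cycle. It has length [size c + 2], hence the bound on [c]. Every junction between blocks has
    this shape up to a common prefix and suffix. *)
Lemma rotation_far x b c z : size c <= 2 ->
  rotation_of_2_3_4 (x :: b ++ rcons c z) (z :: b ++ x :: c).
Proof.
move=> szc; pose ps := 0 :: rev (iota (size b).+1 (size c).+1).
have psE p : (p \in ps) = (p == 0) || (size b < p <= size b + (size c).+1).
  by rewrite inE mem_rev mem_iota addSn ltnS.
have nthb s r : nth 0 (b ++ s) (size b + r) = nth 0 s r.
  by rewrite nth_cat ltnNge leq_addr addKn.
have {}nthb s : (nth 0 (b ++ s) (size b) = nth 0 s 0) *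
    (nth 0 (b ++ s) (size b).+1 = nth 0 s 1) *
    (nth 0 (b ++ s) (size b).+2 = nth 0 s 2).
  by have := (nthb s 0, nthb s 1, nthb s 2); rewrite addn0 addn1 addn2.
have neq m : ((m == m.+1) = false) * ((m == m.+2) = false).
  by split; apply/eqP; lia.
exists ps; split; first by rewrite /ps /= size_rev /= size_iota; lia.
split.
- by rewrite cons_uniq rev_uniq iota_uniq mem_rev mem_iota.
- by apply/allP => p; rewrite psE /= size_cat size_rcons; lia.
- by rewrite /= !size_cat size_rcons.
(* The position is the first one, lies in [b], or comes after [b]. In the outer cases [c] is split
   by its length, so that [ps] is explicit and [next] computes. *)
move=> p; have [->|[[p_gt0 le_pb]|[r ->]]] :
    p = 0 \/ (0 < p /\ p <= size b) \/ exists r, p = (size b).+1 + r.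
- case: p => [|p]; first by left.
  by right; case: (ltnP p (size b)) => ?; [left|right; exists (p - size b)]; lia.
- by rewrite {}/ps in psE *; case: c szc {psE} => [|c0 [|c1 [|]]] // _ _;
    rewrite /rev /= nthb.
- move=> _; have p_ps : p \notin ps by rewrite psE; lia.
  rewrite next_nth (negPf p_ps).
  by case: p p_gt0 le_pb {p_ps} => // p _ lt_pb; rewrite /= !nth_cat lt_pb.
rewrite /= size_cat size_rcons => lt_r.
have {lt_r} : r <= size c by lia.
rewrite {}/ps in psE *; case: c szc {psE} => [|c0 [|c1 [|]]] // _;
  case: r => [|[|[|r]]] // _;
  by rewrite ?addn0 ?addn1 ?addn2 /rev /= ?eqSS ?(eq_sym _.+1) ?neq ?eqxx /= ?nthb.
Qed.

Lemma rotation_far_cat a x b c z e : size c <= 2 ->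
  rotation_of_2_3_4 (a ++ x :: b ++ c ++ z :: e) (a ++ z :: b ++ x :: c ++ e).
Proof.
move=> szc; apply: rotation_catl; have := rotation_catr e (rotation_far x b z szc).
by rewrite !cat_cons -!catA cat_rcons.
Qed.

(** [next] fixes every position outside [ps], so the words can differ only on [ps]; past the end
    both read the default 0. *)
Lemma rotation_num_diff n w v : rotation_of_2_3_4 w v -> num_diff n w v <= 4.
Proof.
case=> ps [/andP[_ szps]] [ups psw szv rot]; apply: leq_trans szps.
rewrite /num_diff -size_filter; apply: uniq_leq_size.
  by rewrite filter_uniq ?iota_uniq.
move=> p; rewrite mem_filter => /andP[neq _]; apply: contraNT neq => p_ps.
have [lt_p|le_p] := ltnP p (size w); last by rewrite !nth_default ?szv.
by rewrite rot // next_nth (negPf p_ps).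
Qed.

(** * Gray codes *)

(** Carrying both endpoints as indices means that joining two lists only requires a rotation at the
    junction. *)
Inductive gray : word -> seq word -> word -> Prop :=
| gray_one a : gray a [:: a] a
| gray_cons a b L c : rotation_of_2_3_4 a b -> gray b L c -> gray a (a :: L) c.

Lemma gray_first a L b : gray a L b -> nth [::] L 0 = a.
Proof. by case. Qed.

Lemma gray_last a L b : gray a L b -> last [::] L = b.
Proof. by elim=> // {}a c M d _ grayM <-; case: grayM. Qed.

Lemma gray_nth a L b i :
  gray a L b -> i.+1 < size L -> rotation_of_2_3_4 (nth [::] L i) (nth [::] L i.+1).
Proof.
move=> grayL; elim: grayL i => // {}a c {}L d rot_ac grayL IH [|i] lt_i.
  by rewrite /= (gray_first grayL).
exact: IH.
Qed.

Lemma gray_cat a L b c M d :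
  gray a L b -> rotation_of_2_3_4 b c -> gray c M d -> gray a (L ++ M) d.
Proof.
by elim=> [{}a|{}a e {}L {}b rot_ae _ IH] rot grayM; apply: gray_cons; eauto.
Qed.

Lemma gray_rev a L b : gray a L b -> gray b (rev L) a.
Proof.
elim=> [{}a|{}a c {}L {}b rot_ac _ IH]; first exact: gray_one.
rewrite rev_cons -cats1; apply: gray_cat IH (rotation_sym rot_ac) (gray_one _).
Qed.

(** Serves the two outer levels of the recurrence, over i and over j; [gray_map] serves the
    innermost one. *)
Lemma gray_flatten (F : nat -> seq word) (a b : nat -> word) m n :
    (forall i, m <= i <= m + n -> gray (a i) (F i) (b i)) ->
    (forall i, m <= i < m + n -> rotation_of_2_3_4 (b i) (a i.+1)) ->
  gray (a m) (flatten [seq F i | i <- iota m n.+1]) (b (m + n)).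
Proof.
elim: n m => [|n IHn] m grayF rotF.
  by rewrite /= cats0 addn0; apply: grayF; lia.
rewrite [iota _ _]/= map_cons [flatten _]/= addnS -addSn.
apply: (@gray_cat _ _ (b m) (a m.+1)); [apply: grayF; lia|apply: rotF; lia|].
by apply: IHn => i le_i; [apply: grayF|apply: rotF]; lia.
Qed.

Lemma gray_map (f : nat -> word) m n :
    (forall i, m <= i < m + n -> rotation_of_2_3_4 (f i) (f i.+1)) ->
  gray (f m) [seq f i | i <- iota m n.+1] (f (m + n)).
Proof.
move=> rotf; rewrite -[map f _]flatten_seq1 -map_comp.
by apply: (gray_flatten (F := fun i => [:: f i]) (a := f)) => // i _; apply: gray_one.
Qed.

Lemma size_signed_list L i : size (signed_list L i) = size L.
Proof. by rewrite /signed_list; case: ifP; rewrite ?size_rev. Qed.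

(** * The lists D *)

(* The last word of [D n] if [b] is false, and the first one if [b] is true. *)
Definition extremal_word (n : nat) (b : bool) : word :=
  if b then if n is m.+1 then n :: iota 1 m else [::] else iota 1 n.

Lemma gray_signed_list n i :
    gray (extremal_word n true) (D n) (extremal_word n false) ->
  gray (extremal_word n (odd i)) (signed_list (D n) i) (extremal_word n (~~ odd i)).
Proof. by rewrite /signed_list; case: (odd i) => // /gray_rev. Qed.

Lemma shiftw_iota m n l : shiftw (iota m n) l = iota (m + l) n.
Proof. by rewrite addnC iotaDl; apply: eq_map => x; rewrite addnC. Qed.

(* The step from the block i+1 to the block i+2 of the list D n; the booleans
   record the parities of the exponents of the prefix and the suffix. *)
Lemma extremal_junction i k n (b c : bool) : n = i + k + 2 ->
  rotation_of_2_3_4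
    (extremal_word i b ++ n :: shiftw (extremal_word k.+1 c) i)
    (extremal_word i.+1 b ++ n :: shiftw (extremal_word k c) i.+1).
Proof.
move=> def_n.
have iotaS m s : iota 1 m.+1 ++ s = iota 1 m ++ m.+1 :: s.
  by rewrite -[in LHS](addn1 m) iotaD add1n -catA.
(* The two suffixes differ only by the letter i+1. What precedes it, [C], is the largest letter of
   the suffix if that comes first and i+1 is a different letter; otherwise [C] is empty. *)
have [C [E [szC -> ->]]] : exists C E : seq nat, [/\ size C <= 1,
    shiftw (extremal_word k.+1 c) i = C ++ i.+1 :: E &
    shiftw (extremal_word k c) i.+1 = C ++ E].
  have [[-> k_gt0]|[def_k1 def_k]] : (c /\ 0 < k) \/
      (extremal_word k.+1 c = iota 1 k.+1 /\ extremal_word k c = iota 1 k).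
  - by case: c k {def_n} => [[|k]|k]; [right|left|right].
  - exists [:: k.+1 + i], (iota i.+2 k.-1); case: k k_gt0 {def_n} => // k _.
    by rewrite /extremal_word /= -/(shiftw _ _) shiftw_iota addSnnS add2n
       add1n shiftw_iota.
  exists [::], (iota i.+2 k); rewrite def_k def_k1 !shiftw_iota.
  by rewrite !add1n.
have [[-> i_gt0]|[-> ->]] : (b /\ 0 < i) \/
    (extremal_word i b = iota 1 i /\ extremal_word i.+1 b = iota 1 i.+1).
- by case: b i {def_n} => [[|i]|i]; [right|left|right].
(* A prefix headed by its maximum exchanges this head with the next larger letter across [n :: C]:
   three or four elements move. *)
- case: i i_gt0 {def_n} => // i _; rewrite /extremal_word 2![(_ :: iota _ _) ++ _]cat_cons iotaS.
  exact: (@rotation_far_cat [::] _ _ (n :: C)).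
(* An increasing prefix stays fixed and [n] itself is the letter [x]: two or three elements move. *)
by rewrite iotaS; apply: (@rotation_far_cat _ _ [::] C); rewrite ltnW.
Qed.

Lemma offsetS i : offset i.+2 = offset i.+1 + catalan i.
Proof. by rewrite /offset /= big_nat_recr. Qed.

(** The two claims are proved together: the indices j and k run up to Catalan numbers, so the sizes
    are needed to know that each range ends at the last word of its list. *)
Lemma size_gray_D n :
  size (D n) = catalan n /\ gray (extremal_word n true) (D n) (extremal_word n false).
Proof.
elim/ltn_ind: n => [[_|n IHn]]; first by split=> //; apply: gray_one.
have sizeD m : m <= n -> size (D m) = catalan m.
  by move=> le_mn; case: (IHn m le_mn).
have grayD m p : m <= n ->
    gray (extremal_word m (odd p)) (signed_list (D m) p) (extremal_word m (~~ odd p)).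
  by move=> le_mn; apply: gray_signed_list; have [] := IHn m le_mn.
rewrite D_rec // /D_step; split.
  rewrite size_flatten /shape -map_comp sumnE big_map -catalan_convolution.
  rewrite -[iota 1 n.+1]/(index_iota 1 n.+2) big_add1 big_mkord.
  by apply: eq_bigr => i _; rewrite /= size_allpairs !size_iota subSS.
have entry1 m p : m <= n -> entry (signed_list (D m) p) 1 = extremal_word m (odd p).
  by move=> le_mn; apply: gray_first (grayD m p le_mn).
have entry_last m p : m <= n ->
    entry (signed_list (D m) p) (catalan m) = extremal_word m (~~ odd p).
  move=> le_mn; rewrite -(gray_last (grayD m p le_mn)) -nth_last.
  by rewrite size_signed_list sizeD.
have entry_rot m p j : m <= n -> 0 < j < catalan m ->
    rotation_of_2_3_4 (entry (signed_list (D m) p) j) (entry (signed_list (D m) p) j.+1).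
  move=> le_mn lt_j; have := @gray_nth _ _ _ j.-1 (grayD m p le_mn).
  by rewrite size_signed_list sizeD // /entry prednK; [apply|]; lia.
(* [a i] and [b i] are the first and last words of block i, at j = k = 1 and at the maximal j and
   k. *)
pose a i := extremal_word i.-1 (odd (n.+1 + i - 1)) ++
  n.+1 :: shiftw (extremal_word (n.+1 - i) (odd (1 + offset i + 1))) (i - 1).
pose b i := extremal_word i.-1 (~~ odd (n.+1 + i - 1)) ++
  n.+1 :: shiftw (extremal_word (n.+1 - i) (~~ odd (catalan i.-1 + offset i + 1))) (i - 1).
have -> : extremal_word n.+1 true = a 1.
  by rewrite /a /offset big_geq // /extremal_word /= if_same subn1 shiftw_iota addn0.
have -> : extremal_word n.+1 false = b (1 + n).
  (* In the last block the prefix exponent 2n+1 is odd, so [D n] is read forwards and ends with the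
     identity. *)
  have -> : b (1 + n) = extremal_word n false ++ [:: n.+1].
    rewrite /b subnn [extremal_word 0 _]if_same /=.
    by have -> : odd (n.+1 + (1 + n) - 1) = true by lia.
  by rewrite /extremal_word -(addn1 n) iotaD add1n addn1.
apply: (gray_flatten (a := a) (b := b)) => i le_i; last first.
  (* From the end of a block to the start of the next, the prefix exponent grows by one, and by
     [offsetS] so does the suffix exponent. Each factor thus passes from the end of one list to the
     start of a list of opposite direction, and its boolean is unchanged. *)
  case: i le_i => // i /andP[_ lt_in]; rewrite /a /b offsetS /= !subn1 /=.
  rewrite (addnC (offset _)) -[0 + _]/(catalan i + offset i.+1).
  have -> : odd (n.+1 + i.+2).-1 = ~~ odd (n.+1 + i.+1).-1 by lia.
  have -> : n.+1 - i.+1 = (n - i.+1).+1 by lia.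
  by rewrite subSS; apply: extremal_junction; lia.
have le_i1 : i.-1 <= n by lia.
have le_i2 : n.+1 - i <= n by lia.
set L := signed_list (D i.-1) (n.+1 + i - 1).
pose a' j := entry L j ++ n.+1 ::
  shiftw (extremal_word (n.+1 - i) (odd (j + offset i + 1))) (i - 1).
pose b' j := entry L j ++ n.+1 ::
  shiftw (extremal_word (n.+1 - i) (~~ odd (j + offset i + 1))) (i - 1).
have -> : a i = a' 1 by rewrite /a /a' entry1.
have -> : b i = b' (1 + (catalan i.-1).-1).
  by rewrite /b /b' add1n prednK ?catalan_gt0 // entry_last.
rewrite -[in iota 1 (catalan i.-1)](prednK (catalan_gt0 i.-1)).
apply: (gray_flatten (a := a') (b := b')) => j le_j; last first.
  (* Passing from j to j+1 flips the direction of the suffix list, so the suffix stays fixed and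
     only the prefix rotates. *)
  by rewrite /a' /b' !addSn /=; apply: rotation_catr; apply: entry_rot => //; lia.
pose f k := entry L j ++ n.+1 ::
  shiftw (entry (signed_list (D (n.+1 - i)) (j + offset i + 1)) k) (i - 1).
have -> : a' j = f 1 by rewrite /a' /f entry1.
have -> : b' j = f (1 + (catalan (n.+1 - i)).-1).
  by rewrite /b' /f add1n prednK ?catalan_gt0 // entry_last.
rewrite -[in iota 1 (catalan _)](prednK (catalan_gt0 (n.+1 - i))).
apply: gray_map => k le_k; apply: rotation_catl; apply: (rotation_catl [:: n.+1]).
by apply: rotation_shiftw; apply: entry_rot => //; lia.
Qed.

Theorem theorem2p3 (n : nat) (hn : 1 <= n) (q : nat)
    (hq : 1 <= q <= catalan n - 1) :
  rotation_of_2_3_4 (entry (D n) q) (entry (D n) q.+1) /\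
  num_diff n (entry (D n) q) (entry (D n) q.+1) <= 4.
Proof.
have [sizeD grayD] := size_gray_D n.
suff rot : rotation_of_2_3_4 (entry (D n) q) (entry (D n) q.+1).
  by split; last exact: rotation_num_diff.
case: q hq => // q lt_q; apply: gray_nth grayD _; lia.
Qed.
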